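(* Let $n\ge 1$ and let $X=(X_{ijk})_{1\le i,j,k\le n}$ be an $n\times n\times n$ array of independent commuting variables. Then the number $L_{n^3}$ of Latin cubes of order $n$ equals the coefficient of the monomial $\prod_{i=1}^n\prod_{j=1}^n\prod_{k=1}^n X_{ijk}$ in $\mathrm{Per}(X)^{n^2}$.
   Context: A Latin cube of order $n$ is an $n\times n\times n$ array $L=(L_{ijk})$ with entries in $[n^2]=\{1,\dots,n^2\}$ such that each symbol of $[n^2]$ occurs exactly once in each $i$-slice (fixed $i$), each $j$-slice (fixed $j$) and each $k$-slice (fixed $k$). $L_{n^3}$ denotes the number of all Latin cubes of order $n$. The hyperpermanent is $\mathrm{Per}(X)=\sum_{\sigma\in S_n}\sum_{\tau\in S_n}\prod_{i=1}^n X_{i,\sigma(i),\tau(i)}$. *)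

(* Defs.v *)
From mathcomp Require Import all_boot all_order all_fingroup all_algebra.
From mathcomp Require Import mpoly.

Set Implicit Arguments.
Unset Strict Implicit.
Unset Printing Implicit Defensive.

Import GRing.Theory.
Local Open Scope ring_scope.

(* The symbols 1, ..., n^2 are encoded as 0, ..., n^2 - 1. *)
Definition latin_cube (n : nat)
    (L : {ffun 'I_n * 'I_n * 'I_n -> 'I_(n ^ 2)}) : bool :=
  [&& [forall i : 'I_n, forall s : 'I_(n ^ 2),
         #|[set u : 'I_n * 'I_n | L (i, u.1, u.2) == s]| == 1%N],
      [forall j : 'I_n, forall s : 'I_(n ^ 2),
         #|[set u : 'I_n * 'I_n | L (u.1, j, u.2) == s]| == 1%N]
    & [forall k : 'I_n, forall s : 'I_(n ^ 2),
         #|[set u : 'I_n * 'I_n | L (u.1, u.2, k) == s]| == 1%N]].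

Definition num_latin_cubes (n : nat) : nat :=
  #|[set L : {ffun 'I_n * 'I_n * 'I_n -> 'I_(n ^ 2)} | latin_cube L]|.

Definition hyperpermanent (R : comNzRingType) (n : nat)
    (X : 'I_n -> 'I_n -> 'I_n -> R) : R :=
  \sum_(sigma : 'S_n) \sum_(tau : 'S_n) \prod_(i < n) X i (sigma i) (tau i).

(* {mpoly R[m]} has its variables indexed by 'I_m, so the triples (i, j, k)
   are numbered through enum_rank, which is a bijection. *)
Definition cube_size (n : nat) : nat := #|{: 'I_n * 'I_n * 'I_n}|.

Definition cube_index (n : nat) (i j k : 'I_n) : 'I_(cube_size n) :=
  enum_rank (i, j, k).

Definition cube_var (n : nat) (i j k : 'I_n) : {mpoly int[cube_size n]} :=
  'X_(cube_index i j k).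

(* Monomials are written additively, as exponent vectors; mpolyX_cube_monomial
   gives the multiplicative form. *)
Definition cube_monomial (n : nat) : 'X_{1..cube_size n} :=
  (\sum_(i < n) \sum_(j < n) \sum_(k < n) U_(cube_index i j k))%MM.

Lemma mpolyX_cube_monomial (n : nat) :
  'X_[int, cube_monomial n] =
  \prod_(i < n) \prod_(j < n) \prod_(k < n) cube_var i j k.
Proof.
have mor I (F : I -> 'X_{1..cube_size n}) (r : seq I) :
    'X_[int, (\sum_(i <- r) F i)%MM] = \prod_(i <- r) 'X_[int, F i].
  by apply: (big_morph (fun m => 'X_[int, m])); [exact: mpolyXD|exact: mpolyX0].
rewrite /cube_monomial mor; apply: eq_bigr => i _.
by rewrite mor; apply: eq_bigr => j _; rewrite mor.
Qed.

(* Main.v *)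
Require Import Defs.
From mathcomp Require Import all_boot all_order all_fingroup all_algebra.
From mathcomp Require Import mpoly.

(** The hyperpermanent is the sum, over pairs of
    permutations (sigma, tau), of the monomial supported on the n cells
    (i, sigma i, tau i), the diagonal of the pair.  So Per(X)^(n^2) is the sum,
    over families g of n^2 such pairs, one per symbol s, of the product of the
    monomials of the diagonals of the g s.  This product is the product of all
    the variables exactly when each cell lies on the diagonal of g s for
    exactly one s, that is, when the diagonals partition the cube; the
    coefficient counts these families (coef_hyperpermanent_exp).

    Latin cubes are the same objects.  In a Latin cube each symbol s occupies
    one cell in every slice of each of the three directions, and such a set of
    cells is the diagonal of a unique pair of permutations.  Thus an array L is
    Latin if and only if its level sets are the diagonals of some family g
    (latin_cubeP), and a family g partitions the cube if and only if its
    diagonals are the level sets of some array L (partitioning_familyP).  L and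
    g determine each other, so the two counts agree. *)

Set Implicit Arguments.
Unset Strict Implicit.
Unset Printing Implicit Defensive.

Import GRing.Theory.
Local Open Scope ring_scope.

(** Counting through a relation, instead of through explicit inverse maps,
    spares choosing a permutation pair or a symbol outside the sets of
    interest. *)
Lemma card_functional_relation (A B : finType) (r : A -> B -> bool)
    (P : pred A) (Q : pred B) :
    (forall a, reflect (exists b, r a b) (P a)) ->
    (forall b, reflect (exists a, r a b) (Q b)) ->
    (forall a b b', r a b -> r a b' -> b = b') ->
    (forall a a' b, r a b -> r a' b -> a = a') ->
  #|[set a | P a]| = #|[set b | Q b]|.
Proof.
move=> domP imP fun_r inj_r.
(* Both sides count the pairs in r: each fibre has at most one element. *)
have fibre (C : finType) (T : pred C) (p : bool) : reflect (exists c, T c) p ->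
    (forall c c', T c -> T c' -> c = c') -> (\sum_c T c = p)%N.
  case=> [[c Tc] uniqT | nT _].
    rewrite (bigD1 c) //= Tc big1 // => c' ne_c'c.
    by apply/eqP; rewrite eqb0; apply: contra ne_c'c => /uniqT/(_ Tc)->.
  rewrite big1 // => c _; apply/eqP; rewrite eqb0.
  by apply/negP=> Tc; apply: nT; exists c.
rewrite -!sum1dep_card [LHS]big_mkcond [RHS]big_mkcond /=.
transitivity (\sum_a \sum_b r a b)%N.
  by apply: eq_bigr => a _; rewrite (fibre _ _ _ (domP a)) //; exact: fun_r.
rewrite exchange_big; apply: eq_bigr => b _.
by rewrite (fibre _ _ _ (imP b)) // => a a'; apply: inj_r.
Qed.

Section LatinCubes.

Variable n : nat.

Implicit Types (c : 'I_n * 'I_n * 'I_n) (p : 'S_n * 'S_n) (s : 'I_(n ^ 2)).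
Implicit Types (L : {ffun 'I_n * 'I_n * 'I_n -> 'I_(n ^ 2)}).
Implicit Types (g : {ffun 'I_(n ^ 2) -> 'S_n * 'S_n}).

Definition on_diagonal p c : bool :=
  (c.1.2 == p.1 c.1.1) && (c.2 == p.2 c.1.1).

Lemma on_diagonal_inj p q : on_diagonal p =1 on_diagonal q -> p = q.
Proof.
move=> eq_pq.
have eq_at i : (p.1 i == q.1 i) && (p.2 i == q.2 i).
  by have := eq_pq (i, p.1 i, p.2 i); rewrite /on_diagonal /= !eqxx => <-.
rewrite [p]surjective_pairing [q]surjective_pairing.
by congr pair; apply/permP=> i; have /andP[/eqP + /eqP] := eq_at i.
Qed.

(** The slices in the first direction make the second and third coordinates
    functions of the first one; those in the other two directions make these
    functions injective. *)
Lemma diagonal_of_transversal (T : pred ('I_n * 'I_n * 'I_n)) :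
    (forall i, #|[set u : 'I_n * 'I_n | T (i, u.1, u.2)]| = 1%N) ->
    (forall j, #|[set u : 'I_n * 'I_n | T (u.1, j, u.2)]| = 1%N) ->
    (forall k, #|[set u : 'I_n * 'I_n | T (u.1, u.2, k)]| = 1%N) ->
  exists p, T =1 on_diagonal p.
Proof.
move=> T1 T2 T3.
have /fin_all_exists[f Tf] i : exists u, forall v, T (i, v.1, v.2) = (v == u).
  have /eqP/cards1P[u /setP def_u] := T1 i.
  by exists u => v; have := def_u v; rewrite !inE.
have Tfi i : T (i, (f i).1, (f i).2) by rewrite Tf.
have inj1 : injective (fun i => (f i).1).
  move=> i i' eq_f; have /eqP/cards1P[u /setP def_u] := T2 (f i).1.
  have := def_u (i, (f i).2); have := def_u (i', (f i').2).
  by rewrite !inE /= Tfi eq_f Tfi => /esym/eqP<- /esym/eqP[].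
have inj2 : injective (fun i => (f i).2).
  move=> i i' eq_f; have /eqP/cards1P[u /setP def_u] := T3 (f i).2.
  have := def_u (i, (f i).1); have := def_u (i', (f i').1).
  by rewrite !inE /= Tfi eq_f Tfi => /esym/eqP<- /esym/eqP[].
exists (perm inj1, perm inj2) => -[[i j] k].
by rewrite (Tf i (j, k)) /on_diagonal /= !permE.
Qed.

Lemma diagonal_transversal p :
  [/\ forall i, #|[set u : 'I_n * 'I_n | on_diagonal p (i, u.1, u.2)]| = 1%N,
      forall j, #|[set u : 'I_n * 'I_n | on_diagonal p (u.1, j, u.2)]| = 1%N
    & forall k, #|[set u : 'I_n * 'I_n | on_diagonal p (u.1, u.2, k)]| = 1%N].
Proof.
case: p => sigma tau; split=> x; apply/eqP/cards1P.
- by exists (sigma x, tau x); apply/setP=> -[j k]; rewrite !inE.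
- exists (sigma^-1 x, tau (sigma^-1 x))%g; apply/setP=> -[i k].
  rewrite !inE /on_diagonal /= xpair_eqE.
  rewrite -(inj_eq (@perm_inj _ sigma) i) permKV eq_sym.
  by case: eqP => // <-; rewrite permK.
- exists (tau^-1 x, sigma (tau^-1 x))%g; apply/setP=> -[i j].
  rewrite !inE /on_diagonal /= xpair_eqE andbC.
  rewrite -(inj_eq (@perm_inj _ tau) i) permKV eq_sym.
  by case: eqP => // <-; rewrite permK.
Qed.

Definition level_diagonals L g : bool :=
  [forall s, forall c, (L c == s) == on_diagonal (g s) c].

Lemma level_diagonalsP L g :
  reflect (forall s c, (L c == s) = on_diagonal (g s) c) (level_diagonals L g).
Proof. by apply: (iffP 'forall_'forall_eqP). Qed.

Definition partitioning_family g : bool :=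
  [forall c, #|[set s | on_diagonal (g s) c]| == 1%N].

Lemma latin_cubeP L : reflect (exists g, level_diagonals L g) (latin_cube L).
Proof.
apply: (iffP and3P) => [[L1 L2 L3] | [g /level_diagonalsP Lg]].
  have /fin_all_exists[g Lg] s :
      exists p, (fun c => L c == s) =1 on_diagonal p.
    apply: diagonal_of_transversal => x; apply/eqP.
    - exact: (forallP (forallP L1 x) s).
    - exact: (forallP (forallP L2 x) s).
    - exact: (forallP (forallP L3 x) s).
  exists (finfun g); apply/level_diagonalsP=> s c.
  by rewrite ffunE; apply: Lg.
have cardE (h : 'I_n * 'I_n -> 'I_n * 'I_n * 'I_n) s :
    #|[set u | L (h u) == s]| = #|[set u | on_diagonal (g s) (h u)]|.
  by apply: eq_card => u; rewrite !inE Lg.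
split; apply/'forall_'forall_eqP => x s;
  have [D1 D2 D3] := diagonal_transversal (g s).
- by rewrite (cardE (fun u => (x, u.1, u.2))).
- by rewrite (cardE (fun u => (u.1, x, u.2))).
- by rewrite (cardE (fun u => (u.1, u.2, x))).
Qed.

Lemma partitioning_familyP g :
  reflect (exists L, level_diagonals L g) (partitioning_family g).
Proof.
apply: (iffP 'forall_cards1P) => [part_g | [L /level_diagonalsP Lg] c].
  have [L Lg] := fin_all_exists part_g.
  exists (finfun L); apply/level_diagonalsP=> s c.
  by have /setP/(_ s) := Lg c; rewrite !inE ffunE eq_sym.
by exists (L c); apply/setP=> s; rewrite !inE -Lg eq_sym.
Qed.

Lemma num_latin_cubes_partitioning :
  num_latin_cubes n = #|[set g | partitioning_family g]|.
Proof.
apply: (card_functional_relation latin_cubeP partitioning_familyP).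
  move=> L g g' /level_diagonalsP Lg /level_diagonalsP Lg'.
  by apply/ffunP=> s; apply: on_diagonal_inj => c; rewrite -Lg Lg'.
move=> L L' g /level_diagonalsP Lg /level_diagonalsP L'g.
by apply/ffunP=> c; apply/eqP; rewrite Lg -L'g.
Qed.

Definition diagonal_monomial p : 'X_{1..cube_size n} :=
  (\sum_(i < n) U_(cube_index i (p.1 i) (p.2 i)))%MM.

Lemma cube_monomialE c : cube_monomial n (enum_rank c) = 1%N.
Proof.
case: c => -[i j] k; rewrite /cube_monomial !pair_bigA /= mnm_sumE.
rewrite (bigD1 (i, j, k)) //= mnm1E eqxx big1 // => -[[i' j'] k'] ne_c.
by rewrite mnm1E /cube_index (inj_eq enum_rank_inj) (negPf ne_c).
Qed.

Lemma diagonal_monomialE p c :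
  diagonal_monomial p (enum_rank c) = on_diagonal p c.
Proof.
case: c => -[i j] k; rewrite mnm_sumE (bigD1 i) //= big1 ?addn0 => [|i' ne_i].
  rewrite mnm1E /cube_index (inj_eq enum_rank_inj) !xpair_eqE eqxx /=.
  by rewrite /on_diagonal /= eq_sym (eq_sym k).
by rewrite mnm1E /cube_index (inj_eq enum_rank_inj) !xpair_eqE (negPf ne_i).
Qed.

Lemma hyperpermanent_cube_var :
  hyperpermanent (@cube_var n) = \sum_p 'X_[int, diagonal_monomial p].
Proof.
rewrite /hyperpermanent pair_bigA; apply: eq_bigr => p _.
rewrite (big_morph (fun m => 'X_[int, m]) (@mpolyXD _ _) (@mpolyX0 _ _)).
by apply: eq_bigr.
Qed.

Lemma partitioning_family_monomial g :
  ((\sum_s diagonal_monomial (g s))%MM == cube_monomial n)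
    = partitioning_family g.
Proof.
have expE c : (\sum_s diagonal_monomial (g s))%MM (enum_rank c)
    = #|[set s | on_diagonal (g s) c]|.
  rewrite mnm_sumE -sum1dep_card [RHS]big_mkcond /=.
  by apply: eq_bigr => s _; rewrite diagonal_monomialE.
apply/eqP/'forall_eqP => [eq_m c | part_g].
  by rewrite -expE eq_m cube_monomialE.
apply/mnmP=> x; rewrite -(enum_valK x) cube_monomialE.
by rewrite expE part_g.
Qed.

Lemma coef_hyperpermanent_exp :
  (hyperpermanent (@cube_var n) ^+ (n ^ 2)%N)@_(cube_monomial n)
    = #|[set g | partitioning_family g]|%:Z.
Proof.
rewrite hyperpermanent_cube_var -[X in _ ^+ X]card_ord -prodr_const.
rewrite bigA_distr_bigA raddf_sum /= -sum1dep_card -natz natr_sum.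
rewrite [RHS]big_mkcond /=.
apply: eq_bigr => g _.
rewrite -(big_morph (fun m => 'X_[int, m]) (@mpolyXD _ _) (@mpolyX0 _ _)).
by rewrite mcoeffX partitioning_family_monomial; case: ifP.
Qed.

End LatinCubes.

Theorem theorem5p2 (n : nat) (hn : (1 <= n)%N) :
  (num_latin_cubes n)%:Z =
  (hyperpermanent (@cube_var n) ^+ (n ^ 2)%N)@_(cube_monomial n).
Proof. by rewrite num_latin_cubes_partitioning coef_hyperpermanent_exp. Qed.
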